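(* Assume $2^{<\mathfrak{c}}=\mathfrak{c}$. Let $X$ be a normal Hausdorff sequential cellular-Lindelöf space such that $\chi(X) \leq \mathfrak{c}$. Then $|X| \leq \mathfrak{c}$.
   Context: Here $\mathfrak{c}=2^{\aleph_0}$ is the cardinality of the continuum, and $2^{<\mathfrak{c}}=\sup\{2^{\kappa}:\kappa<\mathfrak{c},\ \kappa \text{ a cardinal}\}$. A cellular family in a topological space $X$ is a family of pairwise disjoint non-empty open subsets of $X$. A space $X$ is called cellular-Lindelöf if for every cellular family $\mathcal{U}$ in $X$ there is a Lindelöf subspace $L$ of $X$ such that $U \cap L \neq \emptyset$ for every $U \in \mathcal{U}$. A space is sequential if every subset that contains the limits of all of its convergent sequences is closed. The character $\chi(X)$ is the least infinite cardinal $\kappa$ such that every point of $X$ has a local base of cardinality at most $\kappa$. *)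

(* Defs.v *)
From HB Require Import structures.
From mathcomp Require Import all_boot all_order all_algebra.
From mathcomp Require Import all_classical all_reals all_analysis.

Set Implicit Arguments.
Unset Strict Implicit.
Unset Printing Implicit Defensive.

Local Open Scope classical_set_scope.
Local Open Scope card_scope.

(* A cardinal is represented by a type of that cardinality, and cardinals are
   compared through card_le; 2 ^ K is the cardinal of the power set set K. *)

Definition card_lt (T U : Type) (A : set T) (B : set U) : Prop :=
  A #<= B /\ ~ (B #<= A).

Definition continuum : Type := set nat.

(* P is 2 ^ (< C), the supremum of the cardinals 2 ^ K for K < C. *)
Definition is_weak_power (C P : Type) : Prop :=
  (forall K : Type, card_lt [set: K] [set: C] -> [set: set K] #<= [set: P]) /\
  (forall Q : Type,
     (forall K : Type,
        card_lt [set: K] [set: C] -> [set: set K] #<= [set: Q]) ->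
     [set: P] #<= [set: Q]).

Section Spaces.
Variable X : topologicalType.
Implicit Types (A L : set X) (x : X).

Definition cellular_family (F : set (set X)) : Prop :=
  (forall U, F U -> open U /\ U !=set0) /\ trivIset F id.

(* L is Lindelof in the subspace topology; as in cover_compact, the covers are
   made of open sets of the ambient space. *)
Definition lindelof L : Prop :=
  forall F : set (set X), F `<=` open -> L `<=` \bigcup_(U in F) U ->
  exists G : set (set X),
    [/\ G `<=` F, countable G & L `<=` \bigcup_(U in G) U].

Definition cellular_lindelof : Prop :=
  forall F : set (set X), cellular_family F ->
  exists2 L : set X, lindelof L & forall U, F U -> U `&` L !=set0.

Definition sequential_space : Prop :=
  forall A,
    (forall (u : nat -> X) x,
       (forall n, A (u n)) -> u n @[n --> \oo] --> x -> A x) ->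
    closed A.

Definition local_base x (B : set (set X)) : Prop :=
  B `<=` open_nbhs x /\ filter_from B id --> x.

Definition local_bases_le (K : Type) : Prop :=
  forall x, exists2 B : set (set X), local_base x B & B #<= [set: K].

Definition is_character (K : Type) : Prop :=
  [/\ infinite_set [set: K], local_bases_le K &
      forall K' : Type, infinite_set [set: K'] -> local_bases_le K' ->
        [set: K] #<= [set: K']].

End Spaces.

(* Main.v *)
(* Under 2^<c = c the cardinal c is regular, and c^k <= c for k < c. A closing-off
   recursion of length c therefore lists a set Y of at most c points of X that is
   closed under limits of sequences, hence closed, and such that whenever fewer than
   c basic open sets taken at points of Y have a union that is not dense in X, some
   point of Y lies outside the closure of this union. Suppose that p lies outside Y = {y_i : i < c}. Normality
   gives basic neighbourhoods U_i of y_i whose unions all have closures avoiding p,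
   and an open set N with Y in N and cl N covered by the U_i. By recursion one finds
   y_(gam a) in Y outside the closure of the union of U_i and U_(gam i), i < a; removing
   this closure from the trace of U_(gam a) on N gives a cellular family V_a, a < c.
   A Lindelof L meeting every V_a has L /\ cl N covered by countably many U_i; as c has
   uncountable cofinality their indices lie below some a, but V_a avoids these U_i. *)
Require Import Defs.
From HB Require Import structures.
From mathcomp Require Import all_boot all_order all_algebra.
From mathcomp Require Import all_classical all_reals all_analysis.
From mathcomp Require Import wochoice.
From Stdlib Require Import Inverse_Image.

Set Implicit Arguments.
Unset Strict Implicit.
Unset Printing Implicit Defensive.

Local Open Scope classical_set_scope.
Local Open Scope card_scope.

(** * Well-founded recursion and well-orders of initial type *)

Definition initial_order (T : Type) (lt : T -> T -> Prop) : Prop :=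
  [/\ well_founded lt, forall x y z, lt x y -> lt y z -> lt x z,
      forall x y, lt x y \/ x = y \/ lt y x &
      forall a, ~ ([set: T] #<= [set x | lt x a])].

Lemma well_founded_min (T : Type) (lt : T -> T -> Prop) (P : set T) :
  well_founded lt -> P !=set0 -> exists2 a, P a & forall x, lt x a -> ~ P x.
Proof.
move=> wf [x]; elim/(well_founded_ind wf): x => x IH Px.
by have [[y [yx Py]]|/forallNP H] := pselect (exists y, lt y x /\ P y);
   [exact: IH yx Py | exists x => // y yx Py; exact: (H y)].
Qed.

(** [F] receives a total function, with the dummy [u0] outside the segment below [x]; this keeps
    dependent types out of later recursions. *)
Lemma wf_rec (T U : Type) (lt : T -> T -> Prop) (u0 : U)
    (F : T -> (T -> U) -> U) :
  well_founded lt ->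
  exists f : T -> U, forall x, f x = F x (fun y => if `[< lt y x >] then f y else u0).
Proof.
move=> wf.
pose G x (h : forall y, lt y x -> U) :=
  F x (fun y => if pselect (lt y x) is left yx then h y yx else u0).
exists (Fix wf (fun=> U) G) => x.
rewrite Fix_eq.
  congr (F x); apply/funext => y.
  by case: pselect => [yx|nyx]; [rewrite asboolT|rewrite asboolF].
move=> z h h' hh'; congr (F z); apply/funext => y.
by case: pselect.
Qed.

Lemma exists_well_order (T : choiceType) : exists lt : T -> T -> Prop,
  [/\ well_founded lt, forall x y z, lt x y -> lt y z -> lt x z &
      forall x y, lt x y \/ x = y \/ lt y x].
Proof.
have [R wR] := well_ordering_principle T.
have minR (A : set T) : A !=set0 -> exists2 x, A x & forall y, A y -> R x y.
  move=> [x Ax]; have [|z [[Az Rz] _]] := wR (mem A).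
    by exists x; rewrite inE.
  exists z; first by rewrite inE in Az.
  by move=> y Ay; apply: Rz; rewrite inE.
have [antiR totR] : antisymmetric R /\ total R.
  have wc : wo_chain R predT by move=> A _; exact: wR.
  split; first by move=> x y; apply: (wo_chain_antisymmetric wc).
  by move=> x y; apply: (wo_chainW wc).
exists (fun x y => ~ R y x); split.
- move=> x; apply: contrapT => nx.
  have [z nz minz] := minR [set x | ~ Acc (fun x y => ~ R y x) x]
    (ex_intro _ x nx).
  by apply: nz; constructor => y nzy; apply: contrapT => /minz.
(* Given [R z x] the three points form a cycle, which is contradicted at the [R]-least of them. *)
- move=> x y z nyx nzy Rzx.
  have [w xyzw Rw] := minR [set x; y; z] (ex_intro _ x (or_introl (or_introl erefl))).
  have [wx wy wz] : [/\ R w x, R w y & R w z].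
    by split; apply: Rw; [left; left|left; right|right].
  case: xyzw => [[] wE|wE]; rewrite {w}wE in Rw wx wy wz; try contradiction.
  by apply: nzy; rewrite (antiR z x) // Rzx.
- move=> x y; have [Rxy|nRxy] := boolP (R x y); last by right; right; exact/negP.
  have [Ryx|nRyx] := boolP (R y x); last by left; exact/negP.
  by right; left; apply: antiR; rewrite Rxy.
Qed.

Lemma card_le_inj (T U : Type) (A : set T) (B : set U) (f : T -> U) :
  (forall x, A x -> B (f x)) -> {in A &, injective f} -> A #<= B.
Proof.
move=> fAB /inj_card_eq; rewrite card_eq_le => /andP[_ Af].
by apply: (card_le_trans Af); apply: subset_card_le => _ [x /fAB Bfx <-].
Qed.

(** If some segment of a well-order has full size, the order is pulled back along an injection into
    the least such segment. New segments then embed in smaller old ones, which are not of full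
    size. *)
Lemma exists_initial_order (T : pointedType) :
  exists lt : T -> T -> Prop, initial_order lt.
Proof.
have [lt [wf tr tot]] := exists_well_order T.
have [H|/existsNP[a0 /contrapT a0P]] :=
  pselect (forall a, ~ ([set: T] #<= [set x | lt x a])); first by exists lt.
have [a aP amin] := @well_founded_min _ _
  [set a | [set: T] #<= [set x | lt x a]] wf (ex_intro _ a0 a0P).
have /pcard_leP[f] := aP.
have fa x : lt (f x) a by exact: (@funS _ _ _ _ f).
have finj : injective f by move=> x y; apply: (@inj _ _ _ f); rewrite inE.
exists (fun x y => lt (f x) (f y)); split.
- exact: wf_inverse_image.
- by move=> x y z; exact: tr.
- by move=> x y; have [|[/finj|]] := tot (f x) (f y); tauto.
- move=> x xP; apply: (amin (f x) (fa x)); apply: card_le_trans xP _.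
  by apply: (@card_le_inj _ _ _ _ f) => // u v _ _; exact: finj.
Qed.

(** * Coding of sequences and cofinality of the continuum *)

Definition enc (u : nat -> set nat) : set nat :=
  [set p | if unpickle p is Some (n, m) then u n m else False].

Definition dec (c : set nat) (n : nat) : set nat := [set m | c (pickle (n, m))].

Lemma encK u : dec (enc u) = u.
Proof.
by apply/funext => n; apply/seteqP; split => m; rewrite /dec /enc /= pickleK.
Qed.

(* Curry [K -> set nat] as [nat -> set K], so that no product with K is needed. *)
Lemma card_fun_continuum (K : Type) :
  [set: set K] #<= [set: set nat] -> [set: K -> set nat] #<= [set: set nat].
Proof.
move=> /pcard_surjP[s sP]; apply/pcard_surjP.
exists (fun c k => [set n | s (dec c n) k]) => f _.
have /choice[u uP] : forall n, exists c, s c = [set k | f k n].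
  by move=> n; have [c _ <-] := sP [set k | f k n] I; exists c.
by exists (enc u) => //; apply/funext => k; rewrite encK; apply/seteqP; split => n /=;
  rewrite uP.
Qed.

(* Koenig's argument: a cofinal family would allow to diagonalize against an
   enumeration of [K -> T]. *)
Lemma fun_not_cofinal (T : pointedType) (lt : T -> T -> Prop) (K : Type)
    (f : K -> T) :
  initial_order lt -> [set: K -> T] #<= [set: T] ->
  exists a, forall k, ~ lt a (f k).
Proof.
move=> [_ _ _ small] /pcard_surjP[s sP]; apply: contrapT => /forallNP cof.
have /choice[g gP] : forall k, exists b, forall x, lt x (f k) -> s x k <> b.
  move=> k; apply: contrapT => /forallNP nb; apply: (small (f k)).
  apply/pcard_surjP; exists (s^~ k) => b _.
  have /existsNP[x] := nb b; move/not_implyP => [xk /contrapT sxk].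
  by exists x.
have [x _ sx] := sP g I.
have /existsNP[k /contrapT xk] := cof x.
by apply: (gP k x xk); rewrite sx.
Qed.

Lemma initial_order_continuum_no_max (lt : set nat -> set nat -> Prop) a :
  initial_order lt -> exists b, lt a b.
Proof.
move=> [_ _ tot small]; apply: contrapT => /forallNP amax.
(* The bit put in front of [c] differs from [a 0], so [f] avoids [a] and injects the continuum into
   the segment below a maximal [a]. *)
pose f (c : set nat) : set nat := [set n | if n is m.+1 then c m else ~ a 0].
apply: (small a); apply: (@card_le_inj _ _ _ _ f) => [c _ /=|c d _ _ fcd].
  have [|[fca|/amax]] := tot (f c) a => //.
  have : f c 0 = a 0 by rewrite fca.
  by rewrite /f /= propeqE; tauto.
apply/seteqP; split => n cn.
  by have : f c n.+1 by []; rewrite fcd.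
by have : f d n.+1 by []; rewrite -fcd.
Qed.

(** * Bounded index sets and the closing-off recursion *)

Definition bounded_by (T : Type) (lt : T -> T -> Prop) (S : set T) : Prop :=
  exists a, S `<=` [set x | lt x a].

Lemma bounded_byU (T : Type) (lt : T -> T -> Prop) (A B : set T) :
  initial_order lt -> bounded_by lt A -> bounded_by lt B ->
  bounded_by lt (A `|` B).
Proof.
move=> [_ tr tot _] [a Aa] [b Bb].
have [ab|[ab|ba]] := tot a b.
- by exists b => x [/Aa xa|/Bb //]; exact: tr xa ab.
- by exists a => x [/Aa //|/Bb]; rewrite /= ab.
- by exists a => x [/Aa //|/Bb xb]; exact: tr xb ba.
Qed.

(** Regularity of the continuum; for [K = nat], its uncountable cofinality. Koenig's argument gives
    a weak bound, and a larger point makes it strict. *)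
Lemma bounded_by_range (lt : set nat -> set nat -> Prop) (K : Type)
    (f : K -> set nat) :
  initial_order lt -> [set: set K] #<= [set: set nat] ->
  bounded_by lt (range f).
Proof.
move=> lt0 /card_fun_continuum/(fun_not_cofinal f lt0)[a fa].
have [b ab] := initial_order_continuum_no_max a lt0.
have [_ tr tot _] := lt0.
exists b => _ [k _ <-] /=; have [ka|[->//|ak]] := tot (f k) a.
  exact: tr ka ab.
by case: (fa k).
Qed.

(** Here the assumption on weak powers enters: a segment has fewer than continuum many points. *)
Lemma card_segment (lt : set nat -> set nat -> Prop) a :
  is_weak_power continuum continuum -> initial_order lt ->
  [set: set [set x | lt x a]] #<= [set: set nat].
Proof.
move=> [+ _] [_ _ _ small]; apply; split.
  by rewrite (card_le_eql (card_setT _)); exact: card_leT.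
by rewrite (card_le_eqr (card_setT _)); exact: small.
Qed.

Lemma bounded_by_image (lt : set nat -> set nat -> Prop) (f : set nat -> set nat)
    (S : set (set nat)) :
  is_weak_power continuum continuum -> initial_order lt ->
  bounded_by lt S -> bounded_by lt (f @` S).
Proof.
move=> wp lt0 [a Sa].
have [b fb] := bounded_by_range (fun x : [set x | lt x a] => f (val x)) lt0
   (card_segment a wp lt0).
exists b => _ [x Sx <-]; apply: fb.
by have xa : x \in [set x | lt x a] by [rewrite inE; exact: Sa]; exists (SigSub xa).
Qed.

Definition cpair (i c : set nat) : set nat := enc (fun n => if n is 0 then i else c).

Lemma cpair_fst i c : dec (cpair i c) 0 = i.
Proof. by rewrite encK. Qed.

Lemma cpair_snd i c : dec (cpair i c) 1 = c.
Proof. by rewrite encK. Qed.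

(** A bounded set is coded by a bound paired with an index among the subsets of the segment below
    it. *)
Lemma enum_bounded_by (lt : set nat -> set nat -> Prop) :
  is_weak_power continuum continuum -> initial_order lt ->
  exists e : set nat -> set (set nat), forall S, bounded_by lt S ->
    exists c, e c = S.
Proof.
move=> wp lt0.
have /choice[s sP] : forall a, exists s : set nat -> set (set nat),
    forall S, S `<=` [set x | lt x a] -> exists c, s c = S.
  move=> a; have /pcard_surjP[s sP] := card_segment a wp lt0.
  exists (fun c => val @` s c) => S Sa.
  have [c _ cE] := sP [set x | S (val x)] I.
  exists c; rewrite cE; apply/seteqP; split => [_ [x Sx <-] //|x Sx].
  have xa : x \in [set x | lt x a] by rewrite inE; exact: Sa.
  by exists (SigSub xa).
exists (fun c => s (dec c 0) (dec c 1)) => S [a /sP[c cE]].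
by exists (cpair a c); rewrite cpair_fst cpair_snd.
Qed.

(* Each operation is scheduled cofinally often, so it is eventually performed
   after all the points of its bounded support have been listed. *)
Lemma closing_off (lt : set nat -> set nat -> Prop) (I X : Type) (x0 : X)
    (code : set nat -> I) (supp : I -> set (set nat))
    (op : I -> (set nat -> X) -> X) :
  initial_order lt ->
  (forall i f g, (forall k, supp i k -> f k = g k) -> op i f = op i g) ->
  exists y : set nat -> X, forall i, bounded_by lt (supp i) ->
    [set: set nat] #<= code @^-1` [set i] -> exists k, y k = op i y.
Proof.
move=> [wf tr tot small] op_local.
have [y yE] := wf_rec x0 (fun k => op (code k)) wf.
exists y => i [a ia] icof.
have [k ki ka] : exists2 k, code k = i & ~ lt k a.
  apply: contrapT => nk; apply: (small a); apply: card_le_trans icof _.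
  apply: subset_card_le => k ki; apply: contrapT => ka.
  by apply: nk; exists k.
exists k; rewrite yE ki; apply: op_local => j /=.
move=> /ia /= ja; rewrite asboolT//.
have [//|[ka'|ak]] := tot k a; first by rewrite ka'.
exact: tr ja ak.
Qed.

Lemma exists_sequence_closed_reflecting (lt : set nat -> set nat -> Prop) (X : topologicalType)
    (x0 : X) (b : X -> set nat -> set X) :
  is_weak_power continuum continuum -> initial_order lt -> hausdorff_space X ->
  exists y : set nat -> X,
    (forall (u : nat -> set nat) x, y (u n) @[n --> \oo] --> x -> range y x) /\
    (forall S l p, bounded_by lt S ->
       ~ closure (\bigcup_(i in S) b (y i) (l i)) p ->
       exists k, ~ closure (\bigcup_(i in S) b (y i) (l i)) (y k)).
Proof.
move=> wp lt0 hX; have [e eP] := enum_bounded_by wp lt0.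
(* Component 0 of a code selects the operation (reflecting a set of pairs (point,
   basic set) or taking a limit) and component 1 its argument; the others are free,
   so that every operation has continuum many codes. *)
pose code k : set (set nat) + (nat -> set nat) :=
  if `[< dec k 0 0 >] then inl (e (dec k 1)) else inr (dec (dec k 1)).
pose supp (i : set (set nat) + (nat -> set nat)) : set (set nat) :=
  match i with inl D => (dec^~ 0) @` D | inr u => range u end.
pose op (i : set (set nat) + (nat -> set nat)) (f : set nat -> X) : X := xget x0
  match i with
  | inl D => ~` closure (\bigcup_(k in D) b (f (dec k 0)) (dec k 1))
  | inr u => [set x | f (u n) @[n --> \oo] --> x]
  end.
have op_local i f g : (forall k, supp i k -> f k = g k) -> op i f = op i g.
  rewrite /op; case: i => [D|u] /= fg; congr (xget x0 _).
    by congr (~` closure _); apply: eq_bigcupr => k Dk; rewrite fg//; exists k.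
  have -> // : (fun n => f (u n)) = (fun n => g (u n)).
  by apply/funext => n /=; rewrite fg//; exists n.
have [y yP] := closing_off x0 code lt0 op_local.
have cofinal (q : Prop) c :
    [set: set nat] #<= [set k | dec k 0 0 = q /\ dec k 1 = c].
  pose h d := enc (fun n => match n with 0 => [set _ | q] | 1 => c | _ => d end).
  apply: (@card_le_inj _ _ _ _ h) => [d _ /=|d d' _ _ hd]; first by rewrite /h encK.
  have : dec (h d) 2 = dec (h d') 2 by rewrite hd.
  by rewrite /h !encK.
exists y; split.
- move=> u x ux; have [|k yk] := yP (inr u) (bounded_by_range u lt0 (card_lexx _)).
    apply: card_le_trans (cofinal False (enc u)) _; apply: subset_card_le => k [k0 k1].
    by rewrite /code /= k0 k1 encK asboolF.
  exists k => //; rewrite yk /op.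
  apply: (cvg_unique hX _ ux).
  exact: (@xgetPex _ x0 [set x | y (u n) @[n --> \oo] --> x] (ex_intro _ x ux)).
(* [D] codes the graph of [l] over [S]; as the image of a bounded set it is bounded, so [e] lists
   it. *)
- move=> S l p Sb Sp; pose D := [set cpair i (l i) | i in S].
  have suppD : supp (inl D) = S.
    apply/seteqP; split => [_ [_ [i Si <-] <-]|i Si]; first by rewrite cpair_fst.
    by exists (cpair i (l i)); [exists i|rewrite cpair_fst].
  have DE : \bigcup_(k in D) b (y (dec k 0)) (dec k 1) = \bigcup_(i in S) b (y i) (l i).
    by rewrite bigcup_image; apply: eq_bigcupr => i _; rewrite cpair_fst cpair_snd.
  have [c cD] := eP D (bounded_by_image _ wp lt0 Sb).
  have [||k yk] := yP (inl D); first by rewrite suppD.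
    apply: card_le_trans (cofinal True c) _; apply: subset_card_le => k [k0 k1].
    by rewrite /code /= k0 k1 cD asboolT.
  exists k; rewrite yk /op DE.
  by apply: (@xgetPex _ x0 (~` closure (\bigcup_(i in S) b (y i) (l i)))); exists p.
Qed.

(** * Normality, local bases and the cellular family *)

Lemma normal_space_shrink (X : topologicalType) (A B : set X) :
  normal_space X -> closed A -> open B -> A `<=` B ->
  exists O, [/\ open O, A `<=` O & closure O `<=` B].
Proof.
move=> nX cA oB AB; have [|W AW WB] := nX A cA B.
  by move=> x Ax; apply: open_nbhs_nbhs; split => //; exact: AB.
exists W°; split; [exact: open_interior|by move=> x /AW|].
by apply: subset_trans WB; apply: closureS; exact: interior_subset.
Qed.

Lemma local_bases_enum (X : topologicalType) (K : Type) :
  local_bases_le X K -> [set: K] #<= [set: continuum] ->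
  exists b : X -> set nat -> set X, (forall x c, open_nbhs x (b x c)) /\
    (forall x N, nbhs x N -> exists c, b x c `<=` N).
Proof.
move=> XK KC; suff /choice[b bP] : forall x, exists b : set nat -> set X,
    (forall c, open_nbhs x (b c)) /\
    (forall N, nbhs x N -> exists c, b c `<=` N).
  by exists b; split => x; [exact: (bP x).1|exact: (bP x).2].
move=> x; have [B [Bx Bbase] /card_le_trans/(_ KC)/pcard_surjP[g gB]] := XK x.
(* Where [g c] is not in [B], the whole space serves as an open neighbourhood. *)
exists (fun c => if `[< B (g c) >] then g c else setT); split => [c|N].
  by case: asboolP => [/Bx //|_]; split => //; exact: openT.
by move=> /Bbase[U BU UN]; have [c _ cU] := gB U BU; exists c; rewrite cU asboolT.
Qed.

Lemma reflecting_range_eq_setT (lt : set nat -> set nat -> Prop) (X : topologicalType)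
    (b : X -> set nat -> set X) (y : set nat -> X) :
  is_weak_power continuum continuum -> initial_order lt ->
  normal_space X -> hausdorff_space X -> cellular_lindelof X ->
  (forall x c, open_nbhs x (b x c)) ->
  (forall x N, nbhs x N -> exists c, b x c `<=` N) ->
  closed (range y) ->
  (forall S l p, bounded_by lt S ->
     ~ closure (\bigcup_(i in S) b (y i) (l i)) p ->
     exists k, ~ closure (\bigcup_(i in S) b (y i) (l i)) (y k)) ->
  range y = setT.
Proof.
move=> wp lt0 nX hX clX bnbhs bbase cY refl_y; apply/seteqP; split => // p _.
apply: contrapT => Yp; have [wf tr tot small] := lt0.
(* [W] keeps [p] out of the closure of every union of sets [U i], as [refl_y] requires. *)
have [W [oW YW Wp]] : exists W, [/\ open W, range y `<=` W & closure W `<=` ~` [set p]].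
  apply: normal_space_shrink => //; last by move=> x Yx /= xp; apply: Yp; rewrite -xp.
  by apply: closed_openC; apply: accessible_closed_set1; exact: hausdorff_accessible.
have /choice[l lW] : forall i, exists c, b (y i) c `<=` W.
  by move=> i; apply: bbase; apply: open_nbhs_nbhs; split => //; apply: YW; exists i.
pose U i := b (y i) (l i).
have oU i : open (U i) by exact: (bnbhs _ _).1.
have yU i : U i (y i) by exact: (bnbhs _ _).2.
have /choice[g gP] : forall S, exists k, bounded_by lt S ->
    ~ closure (\bigcup_(i in S) U i) (y k).
  move=> S; have [Sb|nSb] := pselect (bounded_by lt S); last by exists point.
  have [|k yk] := refl_y S l p Sb; last by exists k.
  move=> Sp; apply: (Wp p) => //; apply: closureS Sp.
  by move=> x [i _ /lW].
have [gam gamE] := wf_rec point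
  (fun a f => g ([set i | lt i a] `|` f @` [set i | lt i a])) wf.
pose S a := [set i | lt i a] `|` gam @` [set i | lt i a].
have Sb a : bounded_by lt (S a).
  have ab : bounded_by lt [set i | lt i a] by exists a.
  by apply: bounded_byU => //; exact: bounded_by_image.
have gamP a : ~ closure (\bigcup_(i in S a) U i) (y (gam a)).
  rewrite gamE.
  have -> : (fun j => if `[< lt j a >] then gam j else point) @` [set i | lt i a] =
      gam @` [set i | lt i a].
    by apply: eq_imagel => j ja; rewrite asboolT.
  exact: gP.
have [N [oN YN NU]] : exists N,
    [/\ open N, range y `<=` N & closure N `<=` \bigcup_(i in setT) U i].
  apply: normal_space_shrink => //; first by apply: bigcup_open.
  by move=> _ [i _ <-]; exists i.
pose V a := U (gam a) `&` N `&` ~` closure (\bigcup_(i in S a) U i).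
have VU a i z : S a i -> V a z -> ~ U i z.
  by move=> Sai [_ nz] Uiz; apply: nz; apply: subset_closure; exists i.
(* [gam a] belongs to [S a'], so [V a'] avoids [U (gam a)], which contains [V a]. *)
have V_disj a a' z : lt a a' -> V a z -> ~ V a' z.
  move=> aa' [[Uz _] _] /VU; apply; [|exact: Uz].
  by right; exists a.
have [|L linL LV] := clX (range V).
  split => [_ [a _ <-]|_ _ [a _ <-] [a' _ <-] [z [/= Vz V'z]]].
    split; last first.
      by exists (y (gam a)); split; [split => //; apply: YN; exists (gam a)|exact: gamP].
    apply: openI; first exact: openI.
    by apply: closed_openC; exact: closed_closure.
  by have [/V_disj H|[->//|/V_disj H]] := tot a a'; [case: (H z)|case: (H z)].
(* [L] may leave the closure of [N], so the complement of this closure completes the cover. *)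
have [|z Lz|G [GF cG LG]] := linL (~` closure N |` range U).
- move=> _ [->|[i _ <-] //]; apply: closed_openC; exact: closed_closure.
- have [/NU[i _ Uiz]|nNz] := pselect (closure N z).
    by exists (U i) => //; right; exists i.
  by exists (~` closure N) => //; left.
have /choice[idx idxP] : forall A, exists i, range U A -> U i = A.
  by move=> A; have [[i _ <-]|nA] := pselect (range U A); [exists i|exists point].
have /pcard_surjP[s sG] : G #<= [set: nat] by exact: cG.
(* All indices of the countable subcover lie below one [a], hence in [S a], so [V a] misses the
   corresponding [U i]. *)
have [a ia] := bounded_by_range (idx \o s) lt0 (card_lexx _).
have [z [Vz Lz]] := LV (V a) (ex_intro2 _ _ a I erefl).
have [A GA Az] := LG z Lz.
have [AN|/idxP UA] := GF A GA.
  by rewrite AN in Az; apply: Az; apply: subset_closure; case: Vz => -[].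
have [n _ sn] := sG A GA.
apply: (@VU a (idx A) z) => //; last by rewrite UA.
by left; apply: ia; exists n => //=; rewrite sn.
Qed.

Theorem theorem10
  (weak_power_continuum : is_weak_power continuum continuum)
  (X : topologicalType)
  (X_normal : normal_space X)
  (X_hausdorff : hausdorff_space X)
  (X_sequential : sequential_space X)
  (X_cellular_lindelof : cellular_lindelof X)
  (chi : Type)
  (chiE : is_character X chi)
  (chi_le : [set: chi] #<= [set: continuum]) :
  [set: X] #<= [set: continuum].
Proof.
have [->|/set0P[x0 _]] := eqVneq [set: X] set0; first exact: card_ge0.
have [lt lt0] := exists_initial_order (set nat : pointedType).
have [_ bases _] := chiE; have [b [bnbhs bbase]] := local_bases_enum bases chi_le.
have [y [y_lim y_refl]] :=
  exists_sequence_closed_reflecting x0 b weak_power_continuum lt0 X_hausdorff.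
have cY : closed (range y).
  apply: X_sequential => u x Yu.
  have /choice[v vu] : forall n, exists k, y k = u n.
    by move=> n; have [k _ <-] := Yu n; exists k.
  have -> : u = y \o v by apply/funext => n /=; rewrite vu.
  exact: y_lim.
rewrite -(reflecting_range_eq_setT weak_power_continuum lt0 X_normal X_hausdorff
  X_cellular_lindelof bnbhs bbase cY y_refl).
exact: card_image_le.
Qed.
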